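(* (1) $\dim_H\pi_2(\Gamma)=\dim_H(\Gamma,d_2)=\dim_H\pi_2(\Lambda)=\dim_H(\Lambda,d_2)=1$. (2) For any $p\in[0,1]$, $$\begin{aligned} &\dim_H\pi_2(\Gamma_p)=\dim_H\pi_2(\underline{\Gamma}_p)=\dim_H\pi_2(\overline{\Gamma}_p)\\ =&\dim_H(\Gamma_p,d_2)=\dim_H(\underline{\Gamma}_p,d_2)=\dim_H(\overline{\Gamma}_p,d_2)\\ =&\dim_H\pi_2(\Lambda_p)=\dim_H\pi_2(\underline{\Lambda}_p)=\dim_H\pi_2(\overline{\Lambda}_p)\\ =&\dim_H(\Lambda_p,d_2)=\dim_H(\underline{\Lambda}_p,d_2)=\dim_H(\overline{\Lambda}_p,d_2)=\frac{-p\log p-(1-p)\log(1-p)}{\log 2}, \end{aligned}$$ where $0\log 0:=0$.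
   Context: $\mathbb{N}=\{1,2,3,\dots\}$. $\sigma:\{0,1\}^{\mathbb{N}}\to\{0,1\}^{\mathbb{N}}$ is the shift map $\sigma(w_1w_2w_3\cdots)=w_2w_3\cdots$. For digits, $\overline{0}:=1$, $\overline{1}:=0$, and for $w=w_1w_2\cdots\in\{0,1\}^{\mathbb{N}}$, $\overline{w}:=\overline{w}_1\overline{w}_2\cdots$. The order $<$ on $\{0,1\}^{\mathbb{N}}$ is the lexicographic order. The set of univoque sequences is $$\Gamma:=\{w\in\{0,1\}^{\mathbb{N}}:\overline{w}<\sigma^k w<w\text{ for all }k\ge 1\}.$$ Also $$\Lambda:=\{w\in\{0,1\}^{\mathbb{N}}:\text{the lengths of consecutive }0\text{'s and of consecutive }1\text{'s in }w\text{ are bounded}\}.$$ For $p\in[0,1]$ and $S\in\{\Gamma,\Lambda\}$, the frequency subsets are $$S_p:=\Big\{w\in S:\lim_{n\to\infty}\tfrac{\sharp\{k:1\le k\le n,\,w_k=0\}}{n}=p\Big\},$$ $$\underline{S}_p:=\Big\{w\in S:\liminf_{n\to\infty}\tfrac{\sharp\{k:1\le k\le n,\,w_k=0\}}{n}=p\Big\},\quad \overline{S}_p:=\Big\{w\in S:\limsup_{n\to\infty}\tfrac{\sharp\{k:1\le k\le n,\,w_k=0\}}{n}=p\Big\},$$ where $\sharp$ denotes cardinality. The natural projection $\pi_2:\{0,1\}^{\mathbb{N}}\to[0,1]$ is $\pi_2(w)=\sum_{n=1}^\infty w_n2^{-n}$. The usual metric on $\{0,1\}^{\mathbb{N}}$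 is $d_2(w,v):=2^{-\inf\{k\ge0:\,w_{k+1}\ne v_{k+1}\}}$ (with $2^{-\infty}=0$). For a metric space $(X,d)$ and $A\subset X$, $\dim_H(A,d):=\sup\{s\ge0:\mathcal{H}^s(A,d)=\infty\}$ is the Hausdorff dimension, where $\mathcal{H}^s(\cdot,d)$ is the $s$-dimensional Hausdorff measure; $\sup\emptyset:=0$, so the empty set has dimension $0$. $\dim_H$ without a metric denotes Hausdorff dimension in $[0,1]$ with the Euclidean metric. *)

(* Defs.v *)
From HB Require Import structures.
From mathcomp Require Import all_boot all_order all_algebra.
From mathcomp Require Import all_classical all_reals all_analysis.

Set Implicit Arguments.
Unset Strict Implicit.
Unset Printing Implicit Defensive.

Import Order.TTheory GRing.Theory Num.Theory.
Import numFieldNormedType.Exports.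

Local Open Scope classical_set_scope.
Local Open Scope ring_scope.

(* The ambient space is the set X of points of T with the metric d. *)
Section Hausdorff.
Context {R : realType} {T : Type}.
Variables (X : set T) (d : T -> T -> R).
Local Open Scope ereal_scope.

(* The 0 matters only for U = set0, whose supremum would otherwise be -oo. *)
Definition diam (U : set T) : \bar R :=
  maxe 0 (ereal_sup [set (d x y)%:E | x in U & y in U]).

(* diam(U)^s with 0^0 = 1, except that the empty set always counts for 0. *)
Definition diam_pow (s : R) (U : set T) : \bar R :=
  if U == set0 then 0 else diam U `^ s.

Definition delta_cover (delta : R) (A : set T) (U : nat -> set T) : Prop :=
  [/\ forall i, U i `<=` X,
      forall i, diam (U i) <= delta%:E
    & A `<=` \bigcup_i U i].

Definition hausdorff_premeasure (s delta : R) (A : set T) : \bar R :=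
  ereal_inf [set \sum_(0 <= i <oo) diam_pow s (U i) | U in delta_cover delta A].

(* The premeasure is nonincreasing in delta: this is its limit as delta -> 0. *)
Definition hausdorff_measure (s : R) (A : set T) : \bar R :=
  ereal_sup [set hausdorff_premeasure s delta A | delta in [set e | (0 < e)%R]].

(* Adjoining 0 implements the convention sup set0 = 0. *)
Definition dimH (A : set T) : \bar R :=
  ereal_sup (0 |` [set s%:E | s in
    [set s : R | (0 <= s)%R /\ hausdorff_measure s A = +oo]]).

End Hausdorff.

(* Infinite binary words, indexed from 0: w n is the letter w_(n+1); the      *)
(* digit 1 is true and the digit 0 is false.                                  *)
Definition word : Type := nat -> bool.

Definition shift (w : word) : word := fun n => w n.+1.

Definition compl (w : word) : word := fun n => ~~ w n.

Definition lex_lt (v w : word) : Prop :=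
  exists n, (forall i, (i < n)%N -> v i = w i) /\ v n = false /\ w n = true.

Definition Gamma : set word :=
  [set w | forall k, (1 <= k)%N ->
     lex_lt (compl w) (iter k shift w) /\ lex_lt (iter k shift w) w].

Definition Lambda : set word :=
  [set w | exists M, forall (b : bool) (i l : nat),
     (forall j, (j < l)%N -> w (i + j)%N = b) -> (l <= M)%N].

Section Words.
Variable R : realType.

Definition freq0 (w : word) (n : nat) : R :=
  #|[pred k : 'I_n | w k == false]|%:R / n%:R.

Definition freq (S : set word) (p : R) : set word :=
  [set w | S w /\ freq0 w n @[n --> \oo] --> p].

Definition freq_inf (S : set word) (p : R) : set word :=
  [set w | S w /\ limn_einf (fun n => (freq0 w n)%:E) = p%:E].

Definition freq_sup (S : set word) (p : R) : set word :=
  [set w | S w /\ limn_esup (fun n => (freq0 w n)%:E) = p%:E].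

Definition pi2 (w : word) : R :=
  limn (series (fun n => (w n)%:R / 2 ^+ n.+1 : R)).

Definition d2 (v w : word) : R :=
  match pselect (exists k, v k != w k) with
  | left h => 2^-1 ^+ ex_minn h
  | right _ => 0
  end.

Definition dim_word (A : set word) : \bar R := dimH setT d2 A.

Definition dim_unit (A : set R) : \bar R :=
  dimH `[0, 1] (fun x y : R => `|x - y|) A.

(* ln 0 is a finite value, so that 0 * ln 0 = 0. *)
Definition entropy2 (p : R) : R :=
  (- p * ln p - (1 - p) * ln (1 - p)) / ln 2.

End Words.

(* Main.v *)
(* Univoque words have bounded runs, so Gamma is included in Lambda, and each of
   the frequency sets lies between freq Gamma p and the set of words whose
   frequency of 0 returns arbitrarily close to p infinitely often. As pi2 is
   1-Lipschitz for d2, it suffices to bound the dimension of the latter set from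
   above for d2, and that of pi2 (freq Gamma p) from below.

   Upper bound: a prefix of length n with frequency close to p has Bernoulli
   mass at least 2^(-n s'), where s' is close to the entropy, and the prefixes
   of length n have total mass 1; so for s > s' the cylinders of these prefixes
   have diameters whose s-th powers sum to at most a geometric series.

   Lower bound: a prefix 1^(2L) 0 followed by blocks of length L, the i-th one
   having floor((i+1)Lp) - floor(iLp) zeros, is a univoque word of frequency p.
   There are at least 2^k choices for each block, with k/L close to the entropy,
   so k bits of an arbitrary word can be coded in each block. As runs are
   bounded, decoding is Hoelder of exponent k/L for the Euclidean metric. A
   cover of the image thus yields a cover of [0, 1[, and the countable
   subadditivity of Lebesgue measure bounds it from below. *)
From Pilot Require Import Defs.
From HB Require Import structures.
From mathcomp Require Import all_boot all_order all_algebra.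
From mathcomp Require Import all_classical all_reals all_analysis.
From mathcomp Require Import ring lra zify.

Set Implicit Arguments.
Unset Strict Implicit.
Unset Printing Implicit Defensive.

Import Order.TTheory GRing.Theory Num.Theory.
Import numFieldNormedType.Exports.
Import Pilot.Defs.

Local Open Scope classical_set_scope.
Local Open Scope ring_scope.

(** * Binary expansions *)

Section BinaryExpansion.
Variable R : realType.
Implicit Types u v w : word.

Definition digit_term w : R ^nat := fun n => (w n)%:R / 2 ^+ n.+1.

Lemma digit_series_recl w n :
  series (digit_term w) n.+1 =
  ((w 0%N)%:R + series (digit_term (shift w)) n) / 2.
Proof.
rewrite /series /= big_nat_recl //= /digit_term expr1 mulrDl; congr (_ + _).
rewrite mulr_suml; apply: eq_bigr => i _.
by rewrite /shift -mulrA -invfM -exprSr.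
Qed.

Lemma digit_series_le w n : series (digit_term w) n <= 1 - 2^-1 ^+ n.
Proof.
elim: n w => [|n IH] w; first by rewrite /series /= big_geq // expr0 subrr.
rewrite digit_series_recl exprS.
have := IH (shift w); case: (w 0%N) => /=; lra.
Qed.

Lemma digit_series_ge0 w n : 0 <= series (digit_term w) n.
Proof.
by rewrite /series /=; apply: sumr_ge0 => i _; rewrite /digit_term divr_ge0.
Qed.

Lemma digit_series_cvg w : cvgn (series (digit_term w)).
Proof.
apply: nondecreasing_is_cvgn; last first.
  exists 1 => _ [n _ <-]; apply: le_trans (digit_series_le w n) _.
  by rewrite gerBl exprn_ge0.
apply/nondecreasing_seqP => n.
rewrite /series /= big_nat_recr //= lerDl /digit_term divr_ge0 //.
Qed.

Lemma pi2_recl w : pi2 R w = ((w 0%N)%:R + pi2 R (shift w)) / 2.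
Proof.
rewrite /pi2; apply/cvg_lim => //; rewrite -cvg_shiftS.
under eq_fun do rewrite digit_series_recl.
by apply: cvgMl; apply: cvgD; [exact: cvg_cst|exact: digit_series_cvg].
Qed.

Lemma pi2_ge0 w : 0 <= pi2 R w.
Proof.
apply: limr_ge; first exact: digit_series_cvg.
by apply: nearW => n; exact: digit_series_ge0.
Qed.

Lemma pi2_le1 w : pi2 R w <= 1.
Proof.
apply: limr_le; first exact: digit_series_cvg.
apply: nearW => n; apply: le_trans (digit_series_le w n) _.
by rewrite gerBl exprn_ge0.
Qed.

Lemma pi2_sub_prefix n v w : (forall i, (i < n)%N -> v i = w i) ->
  pi2 R v - pi2 R w =
  2^-1 ^+ n * (pi2 R (iter n shift v) - pi2 R (iter n shift w)).
Proof.
elim: n v w => [|n IH] v w vw; first by rewrite expr0 mul1r.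
rewrite (pi2_recl v) (pi2_recl w) vw // !iterSr exprS.
have := IH (shift v) (shift w) (fun i lt_in => vw i.+1 lt_in); lra.
Qed.

Lemma pi2_dist_le n v w : (forall i, (i < n)%N -> v i = w i) ->
  `|pi2 R v - pi2 R w| <= 2^-1 ^+ n.
Proof.
move=> /pi2_sub_prefix ->; rewrite normrM ger0_norm ?exprn_ge0//.
rewrite ler_piMr ?exprn_ge0//.
have := (pi2_ge0 (iter n shift v), pi2_le1 (iter n shift v)).
have := (pi2_ge0 (iter n shift w), pi2_le1 (iter n shift w)).
by move=> [? ?] [? ?]; rewrite ler_norml; apply/andP; split; lra.
Qed.

Lemma iter_shiftE n w i : iter n shift w i = w (n + i)%N.
Proof. by elim: n w => // n IH w; rewrite iterSr IH addSn. Qed.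

Lemma pi2_ge_digit w n : w n -> 2^-1 ^+ n.+1 <= pi2 R w.
Proof.
elim: n w => [|n IH] w wn; rewrite pi2_recl.
  by rewrite wn expr1 /=; have := pi2_ge0 (shift w); lra.
have := IH (shift w) wn; rewrite [in X in _ -> X]exprS => ?.
have : 0 <= (w 0%N)%:R :> R by []. lra.
Qed.

(* A 1 soon after the larger of two digits keeps the two points away from the
   dyadic point where the two cylinders meet. *)
Lemma pi2_dist_ge n m v w : (forall i, (i < n)%N -> v i = w i) ->
    v n = false -> w n = true -> w (n.+1 + m)%N ->
  2^-1 ^+ (n.+1 + m.+1) <= `|pi2 R v - pi2 R w|.
Proof.
move=> vw vn wn wm; rewrite distrC (@pi2_sub_prefix n); last first.
  by move=> i ?; rewrite vw.
rewrite normrM ger0_norm ?exprn_ge0// addSnnS exprD.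
apply: ler_wpM2l; first by rewrite exprn_ge0.
rewrite !(pi2_recl (iter n shift _)) !iter_shiftE !addn0 vn wn /= add0r.
rewrite -!iterS exprS.
have : 2^-1 ^+ m.+1 <= pi2 R (iter n.+1 shift w).
  by apply: pi2_ge_digit; rewrite iter_shiftE.
have := pi2_le1 (iter n.+1 shift v) => ? ?.
by rewrite ler_normr; apply/orP; left; lra.
Qed.

(** For x in [0, 1[, the integer part of x 2^(n+1) is written with the first n+1 binary digits of x,
    so its parity is the last of them. *)
Definition digits (x : R) : word := fun n => odd (Num.truncn (x * 2 ^+ n.+1)).

Lemma truncn_double (x : R) : 0 <= x ->
  Num.truncn (x * 2) = (odd (Num.truncn (x * 2)) + (Num.truncn x).*2)%N.
Proof.
move=> x0; rewrite -[LHS]odd_double_half; congr (_ + _.*2)%N.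
apply/esym/truncn_def.
have /truncn_itv : 0 <= x * 2 by rewrite mulr_ge0.
set k := Num.truncn _ => /andP[lek ltk].
have : (k./2 * 2 <= k)%N by lia.
have : (k.+1 <= k./2.+1 * 2)%N by lia.
by rewrite -!(ler_nat R) !natrM => ? ?; apply/andP; split; lra.
Qed.

Lemma digit_series_digits (x : R) n : 0 <= x < 1 ->
  series (digit_term (digits x)) n = (Num.truncn (x * 2 ^+ n))%:R / 2 ^+ n.
Proof.
move=> /andP[x0 x1]; elim: n => [|n IH].
  rewrite /series /= big_geq // expr0 mulr1 divr1.
  by rewrite (@truncn_def _ _ 0%N) // x0.
have -> : series (digit_term (digits x)) n.+1 =
    series (digit_term (digits x)) n + digit_term (digits x) n.
  by rewrite /series /= big_nat_recr.
rewrite IH /digit_term /digits.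
rewrite exprSr mulrA.
rewrite [in RHS]truncn_double ?mulr_ge0 ?exprn_ge0// natrD -muln2 natrM.
by field; rewrite ?expf_neq0.
Qed.

Lemma pi2_digits (x : R) : 0 <= x < 1 -> pi2 R (digits x) = x.
Proof.
move=> x01; apply/cvg_lim => //; have /andP[x0 x1] := x01.
apply: (@squeeze_cvgr _ _ _ _ (fun n => x - 2^-1 ^+ n) (fun=> x)).
- apply: nearW => n; rewrite -[series _ n]/(series (digit_term (digits x)) n).
  rewrite digit_series_digits // ler_pdivrMr ?ler_pdivlMr ?exprn_gt0//.
  have /truncn_itv/andP[? lt_xn] : 0 <= x * 2 ^+ n.
    by rewrite mulr_ge0 ?exprn_ge0.
  apply/andP; split=> //.
  rewrite mulrBl exprVn mulVf ?expf_neq0// lerBlDr natr1.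
  exact: ltW.
- rewrite -[X in _ --> X]subr0; apply: cvgB; first exact: cvg_cst.
  by apply: cvg_expr; rewrite ger0_norm // invf_lt1 // ltr1n.
- exact: cvg_cst.
Qed.

End BinaryExpansion.

(** * Hausdorff dimension under Lipschitz and Hoelder maps *)

Section HausdorffTheory.
Local Open Scope ereal_scope.
Context {R : realType} {T : Type}.
Implicit Types (X A U : set T) (d : T -> T -> R) (s h : R).

Lemma diam_ge0 d U : 0 <= diam d U.
Proof. by rewrite /diam le_max lexx. Qed.

Lemma diam_le d U (e : R) : (0 <= e)%R ->
  (forall x y, U x -> U y -> (d x y <= e)%R) -> diam d U <= e%:E.
Proof.
move=> e0 Ue; rewrite /diam ge_max lee_fin e0 /=; apply: ge_ereal_sup.
by move=> _ [x Ux [y Uy <-]]; rewrite lee_fin Ue.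
Qed.

Lemma le_diam d U x y : U x -> U y -> (d x y)%:E <= diam d U.
Proof.
move=> Ux Uy; rewrite /diam le_max; apply/orP; right.
by apply: ereal_sup_ubound; exists x => //; exists y.
Qed.

Lemma diam_pow_ge0 d s U : 0 <= diam_pow d s U.
Proof. by rewrite /diam_pow; case: ifP => // _; exact: poweR_ge0. Qed.

Lemma dimH_le X d A h : (0 <= h)%R ->
  (forall s, (h < s)%R -> hausdorff_measure X d s A < +oo) ->
  dimH X d A <= h%:E.
Proof.
move=> h0 fin; apply: ge_ereal_sup => _ [->|[s [s0 Hs] <-]].
  by rewrite lee_fin.
rewrite lee_fin leNgt; apply/negP => /fin.
by rewrite Hs ltxx.
Qed.

Lemma dimH_ge0 X d A : 0 <= dimH X d A.
Proof. by apply: ereal_sup_ubound; left. Qed.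

Lemma dimH_ge X d A h :
  (forall s, (0 <= s < h)%R -> hausdorff_measure X d s A = +oo) ->
  h%:E <= dimH X d A.
Proof.
move=> inf; rewrite leNgt; apply/negP => lt_dh.
have := dimH_ge0 X d A; move: lt_dh; case E : (dimH X d A) => [r||] //.
rewrite lte_fin lee_fin => lt_rh r0.
have s0h : (0 <= (r + h) / 2 < h)%R by apply/andP; split; lra.
have : ((r + h) / 2)%:E <= dimH X d A.
  apply: ereal_sup_ubound; right; exists ((r + h) / 2)%R => //.
  by split; [case/andP: s0h|exact: inf].
rewrite E lee_fin; lra.
Qed.

End HausdorffTheory.

Section Lipschitz.
Local Open Scope ereal_scope.
Context {R : realType} {T T' : Type}.
Variables (X : set T) (d : T -> T -> R) (X' : set T') (d' : T' -> T' -> R).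
Variable f : T -> T'.
Hypothesis fX : forall x, X x -> X' (f x).
Hypothesis f_le : forall x y, (d' (f x) (f y) <= d x y)%R.

Lemma diam_image_le U : diam d' (f @` U) <= diam d U.
Proof.
rewrite {1}/diam ge_max diam_ge0; apply: ge_ereal_sup.
move=> _ [_ [x Ux <-] [_ [y Uy <-] <-]].
by apply: le_trans (le_diam d Ux Uy); rewrite lee_fin.
Qed.

Lemma diam_pow_image_le s U : (0 <= s)%R ->
  diam_pow d' s (f @` U) <= diam_pow d s U.
Proof.
move=> s0; rewrite /diam_pow.
have [->|U0] := eqVneq U set0; first by rewrite image_set0 eqxx.
case: ifP => _; first exact: poweR_ge0.
apply: gt0_ler_poweR (diam_image_le U) => //;
  by rewrite in_itv /= leey diam_ge0.
Qed.

(** The images of a cover of [A] cover [A'], with no larger diameters. Asking for an inclusion only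
    lets [f = id] give the monotonicity of [dimH]. *)
Lemma hausdorff_measure_image_le s A A' : (0 <= s)%R -> A' `<=` f @` A ->
  hausdorff_measure X' d' s A' <= hausdorff_measure X d s A.
Proof.
move=> s0 A'A; apply: ge_ereal_sup => _ [e e0 <-].
apply: (@le_trans _ _ (hausdorff_premeasure X d s e A)); last first.
  by apply: ereal_sup_ubound; exists e.
apply: le_ereal_inf_tmp => _ [U [UX Ue AU] <-].
apply: (@le_trans _ _ (\sum_(0 <= i <oo) diam_pow d' s (f @` U i))).
  apply: ereal_inf_lbound; exists (fun i => f @` U i) => //; split.
  - by move=> i _ [x /UX/fX ? <-].
  - by move=> i; apply: le_trans (diam_image_le _) (Ue i).
  - move=> _ /A'A[x /AU[i _ Ux] <-]; exists i => //=.
    by exists x.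
apply: lee_nneseries => i *; first exact: diam_pow_ge0.
exact: diam_pow_image_le.
Qed.

Lemma dimH_image_le A A' : A' `<=` f @` A -> dimH X' d' A' <= dimH X d A.
Proof.
move=> A'A; apply: ge_ereal_sup => _ [->|[s [s0 Hs] <-]]; first exact: dimH_ge0.
apply: ereal_sup_ubound; right; exists s => //; split=> //.
by apply/eqP; rewrite -leye_eq -Hs; exact: hausdorff_measure_image_le.
Qed.

End Lipschitz.

Lemma dimH_subset {R : realType} {T : Type} (X : set T) (d : T -> T -> R) A B :
  A `<=` B -> (dimH X d A <= dimH X d B)%E.
Proof.
by move=> AB; apply: (@dimH_image_le _ _ _ _ _ _ _ id) => //; rewrite image_id.
Qed.

Section Holder.
Context {R : realType} {T I : Type}.
Variables (X : set T) (d : T -> T -> R) (A : set T) (g : I -> T) (h : I -> R).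
Variables (C s t : R).
Hypothesis d_ge0 : forall x y, 0 <= d x y.
Hypothesis gA : forall u, A (g u).
Hypothesis h_onto : forall x, 0 <= x < 1 -> exists u, h u = x.
Hypothesis C_gt0 : 0 < C.
Hypothesis st : 0 <= s < t.
Hypothesis h_holder : forall u v, `|h u - h v| <= C * d (g u) (g v) `^ t.

(** Here [g] codes an index by a point of [A] and [h] decodes it into the line. The decoded values
    of a piece of diameter D lie within C D^t of any one of them, and D^t <= e^(t-s) D^s. *)
Lemma holder_piece (e : R) U : 0 < e -> (diam d U <= e%:E)%E ->
  exists J : interval R, h @` [set u | U (g u)] `<=` [set` J] /\
   (lebesgue_measure ([set` J] : set R) <=
    (2 * C * e `^ (t - s))%:E * diam_pow d s U)%E.
Proof.
move=> e0 Ue; have /andP[s0 lt_st] := st.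
have K0 : 0 <= 2 * C * e `^ (t - s) by rewrite !mulr_ge0 ?powR_ge0// ltW.
have [|/set0P[u0 Uu0]] := eqVneq [set u | U (g u)] set0.
  move=> ->; exists `[1, 0]; rewrite image_set0; split=> //.
  rewrite lebesgue_measure_itv /= lte_fin ltr10.
  by rewrite mule_ge0 ?diam_pow_ge0 ?lee_fin.
have [D [D0 De Dd]] : exists D, [/\ 0 <= D, D <= e & diam d U = D%:E].
  have := diam_ge0 d U; move: Ue; case: (diam d U) => // D.
  by rewrite !lee_fin => ? ?; exists D.
exists `[h u0 - C * D `^ t, h u0 + C * D `^ t]; split.
  move=> _ [u Uu <-] /=; rewrite in_itv /= -ler_distlC.
  apply: le_trans (h_holder _ _) _; rewrite ler_pM2l//.
  apply: ge0_ler_powR; rewrite ?nnegrE ?d_ge0// ?(le_trans s0 (ltW _))//.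
  by rewrite -lee_fin -Dd; exact: le_diam.
have -> : diam_pow d s U = (D `^ s)%:E.
  rewrite /diam_pow Dd ifF//; apply/negbTE/set0P.
  by exists (g u0).
rewrite lebesgue_measure_itv /= lte_fin.
have Ds0 := powR_ge0 D s.
have DDs : D `^ t <= e `^ (t - s) * D `^ s.
  (* [D] may be 0; the exponents still add up because [t] is nonzero. *)
  have -> : D `^ t = D `^ (t - s) * D `^ s.
    rewrite -powRD ?subrK//; apply/implyP => /eqP; lra.
  apply: ler_wpM2r => //; apply: ge0_ler_powR;
    by rewrite ?nnegrE ?subr_ge0 ?(ltW lt_st) ?(ltW e0).
have : C * D `^ t <= C * (e `^ (t - s) * D `^ s) by rewrite ler_pM2l.
(* The second case is an interval reduced to a point, of measure 0. *)
case: ifP => _ ?; last by rewrite -EFinM lee_fin mulr_ge0.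
rewrite -EFinB -EFinM lee_fin; lra.
Qed.

(** Every point of [0, 1[ is decoded from a point of [A], so the intervals attached to a cover of
    [A] have total length at least 1. *)
Lemma holder_premeasure_ge (e : R) : 0 < e ->
  (((2 * C * e `^ (t - s))^-1)%:E <= hausdorff_premeasure X d s e A)%E.
Proof.
move=> e0; apply: le_ereal_inf_tmp => _ [U [UX Ue AU] <-].
have [J JP] := choice (fun i => holder_piece e0 (Ue i)).
have K0 : 0 < 2 * C * e `^ (t - s) by rewrite !mulr_gt0 ?powR_gt0.
rewrite -(@lee_pmul2l _ (2 * C * e `^ (t - s))%:E) ?lte_fin//.
rewrite -EFinM divff ?gt_eqF// -nneseriesZl; last first.
  by move=> i _; exact: diam_pow_ge0.
have <- : lebesgue_measure (`[0, 1[%classic : set R) = 1%:E.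
  by rewrite lebesgue_measure_itv /= lte_fin ltr01 -EFinB subr0.
apply: (@le_trans _ _
    (\sum_(0 <= i <oo) lebesgue_measure ([set` J i] : set R))%E).
  apply: measure_sigma_subadditive => //.
  move=> x; rewrite /= in_itv /= => /h_onto[u <-].
  have [i _ Ui] := AU _ (gA u).
  by exists i => //; apply: (JP i).1; exists u.
by apply: lee_nneseries => i *; [exact: measure_ge0|exact: (JP i).2].
Qed.

Lemma holder_measure_infty : hausdorff_measure X d s A = +oo%E.
Proof.
have /andP[s0 lt_st] := st.
have ts : 0 < t - s by rewrite subr_gt0.
apply/eqyP => M M0.
(* Solves 2 C e^(t-s) = 1/M, so that the bound of [holder_premeasure_ge] is exactly M. *)
pose e := (2 * C * M)^-1 `^ (t - s)^-1.
have e0 : 0 < e by rewrite powR_gt0 // invr_gt0 !mulr_gt0.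
apply: (@le_trans _ _ (hausdorff_premeasure X d s e A)); last first.
  by apply: ereal_sup_ubound; exists e.
apply: le_trans (holder_premeasure_ge e0); rewrite lee_fin.
rewrite /e -powRrM mulVf ?gt_eqF// powRr1; last first.
  by rewrite invr_ge0 !mulr_ge0 // ltW.
have -> : (2 * C * (2 * C * M)^-1)^-1 = M by field; rewrite !gt_eqF.
by [].
Qed.

End Holder.

(** * The upper bound *)

(* Nodes of the binary tree are numbered as in a heap: the root is 1 and the
   children of j are 2j and 2j+1, so level n occupies [2^n, 2^(n+1)[. *)
Fixpoint node (w : word) (n : nat) : nat :=
  if n is m.+1 then (w m + (node w m).*2)%N else 1.

Lemma node_itv w n : (2 ^ n <= node w n < 2 ^ n.+1)%N.
Proof.
elim: n => // n /andP[le_n lt_n] /=; rewrite !expnS.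
move: lt_n; rewrite expnS => lt_n.
by case: (w n); lia.
Qed.

Lemma node_level v w m n : node v m = node w n -> m = n.
Proof.
move=> vw; have /andP[le_m lt_m] := node_itv v m.
have /andP[le_n lt_n] := node_itv w n.
have : (2 ^ m < 2 ^ n.+1)%N by rewrite (leq_ltn_trans le_m) // vw.
have : (2 ^ n < 2 ^ m.+1)%N by rewrite (leq_ltn_trans le_n) // -vw.
by rewrite !ltn_exp2l //; lia.
Qed.

Lemma node_prefix v w n : node v n = node w n ->
  forall i, (i < n)%N -> v i = w i.
Proof.
elim: n => // n IH /= vw i.
have wv : v n = w n by case: (v n) vw; case: (w n) => //; lia.
rewrite ltnS leq_eqVlt => /orP[/eqP -> //|]; apply: IH.
by move: vw; rewrite wv; lia.
Qed.

Lemma exprn_powR (R : realType) (x s : R) n : 0 <= x ->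
  (x ^+ n) `^ s = (x `^ s) ^+ n.
Proof.
move=> x0; rewrite -(powR_mulrn n x0) -powRrM mulrC powRrM.
by rewrite (powR_mulrn n (powR_ge0 _ _)).
Qed.

Section CylinderCover.
Variable R : realType.

Lemma d2_le_prefix n (v w : word) : (forall i, (i < n)%N -> v i = w i) ->
  d2 R v w <= 2^-1 ^+ n.
Proof.
move=> vw; rewrite /d2; case: pselect => [h|_]; last by rewrite exprn_ge0.
case: ex_minnP => m vwm _; apply: ler_wiXn2l => //; first by lra.
by rewrite leqNgt; apply: contraNN vwm => /vw ->.
Qed.

Lemma pi2_lipschitz (v w : word) : `|pi2 R v - pi2 R w| <= d2 R v w.
Proof.
rewrite /d2; case: pselect => [h|h].
  case: ex_minnP => m _ min_m; apply: pi2_dist_le => i lt_im.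
  by apply/eqP; apply: contraTT lt_im => /min_m; rewrite -leqNgt.
suff -> : v = w by rewrite subrr normr0.
by apply/funext => k; apply/eqP; apply: contra_notT h => ?; exists k.
Qed.

Variable q : R.

(** Mass of the cylinder at node [j] of level [n] when letters are independent and 0 has probability
    [q]: [j./2] is the parent, and the parity of [j] the last letter. *)
Fixpoint bernoulli_mass (n j : nat) : R :=
  if n is m.+1 then bernoulli_mass m j./2 * (if odd j then 1 - q else q) else 1.

Lemma bernoulli_mass_node w n : bernoulli_mass n (node w n) =
  \prod_(i < n) (if w i then 1 - q else q).
Proof.
elim: n => [|n IH]; first by rewrite big_ord0.
rewrite big_ord_recr /= -IH oddD odd_double addbF oddb.
by rewrite half_bit_double.
Qed.

Lemma sum_nat_double (F : nat -> R) a k :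
  \sum_(a.*2 <= j < (a + k).*2) F j =
  \sum_(a <= i < a + k) (F i.*2 + F i.*2.+1).
Proof.
elim: k => [|k IH]; first by rewrite addn0 !big_geq.
rewrite addnS doubleS !big_nat_recr ?IH ?leq_addr//=; [ring|lia|lia].
Qed.

Lemma sum_bernoulli_mass n :
  \sum_(2 ^ n <= j < 2 ^ n.+1) bernoulli_mass n j = 1.
Proof.
elim: n => [|n IH]; first by rewrite big_nat1.
have -> : (2 ^ n.+1 = (2 ^ n).*2)%N by rewrite expnS mul2n.
have -> : (2 ^ n.+2 = (2 ^ n + 2 ^ n).*2)%N by rewrite !expnS; lia.
rewrite sum_nat_double /=.
have -> : (2 ^ n + 2 ^ n = 2 ^ n.+1)%N by rewrite !expnS; lia.
rewrite -[RHS]IH; apply: eq_bigr => i _.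
by rewrite /= odd_double doubleK uphalf_double /=; ring.
Qed.

Variables (s rho : R) (A : set word).
Hypothesis q01 : 0 < q < 1.
Hypothesis s_ge0 : 0 <= s.
Hypothesis lt_rho : 2^-1 `^ s < rho.
Hypothesis A_heavy : forall w, A w -> forall N, exists2 n, (N <= n)%N &
  rho ^+ n <= bernoulli_mass n (node w n).

(** Indexing by nodes makes the cover a sequence. This is the whole cylinder of [j] if that node is
    heavy (of mass at least rho^n, n being its level) and of level at least [N]; otherwise it is
    empty, in particular for j = 0. *)
Let cylinder N j : set word := [set w | exists n,
  [/\ (N <= n)%N, node w n = j & rho ^+ n <= bernoulli_mass n j]].

Let theta := 2^-1 `^ s / rho.

Let rho_gt0 : 0 < rho.
Proof. by apply: le_lt_trans lt_rho; exact: powR_ge0. Qed.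

Let theta_ge0 : 0 <= theta.
Proof. by rewrite divr_ge0 ?powR_ge0 // ltW. Qed.

Let theta_lt1 : theta < 1.
Proof. by rewrite ltr_pdivrMr // mul1r. Qed.

Let mass_ge0 n j : 0 <= bernoulli_mass n j.
Proof.
have /andP[? ?] := q01.
elim: n j => [|n IH] j //=.
by apply: mulr_ge0 => //; case: ifP => _; lra.
Qed.

Let diam_cylinder N j : (diam (d2 R) (cylinder N j) <= (2^-1 ^+ N)%:E)%E.
Proof.
apply: diam_le; first by rewrite exprn_ge0.
move=> v w [m [Nm vm _]] [n [Nn wn _]].
have mn : m = n by apply: (@node_level v w); rewrite vm wn.
apply: (@le_trans _ _ (2^-1 ^+ n)); last by apply: ler_wiXn2l => //; lra.
by apply: d2_le_prefix; apply: node_prefix; rewrite wn -mn.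
Qed.

(** The diameter is at most 2^-n, and (2^-n)^s = theta^n rho^n, where rho^n is at most the mass of a
    heavy node. *)
Let diam_pow_cylinder N n j : (2 ^ n <= j < 2 ^ n.+1)%N ->
  (diam_pow (d2 R) s (cylinder N j) <= (theta ^+ n * bernoulli_mass n j)%:E)%E.
Proof.
move=> /andP[le_j lt_j].
have lvl w m : node w m = j -> m = n.
  move=> wm; have := node_itv w m; rewrite wm => /andP[le_m lt_m].
  have : (2 ^ m < 2 ^ n.+1)%N by exact: leq_ltn_trans lt_j.
  have : (2 ^ n < 2 ^ m.+1)%N by exact: leq_ltn_trans lt_m.
  by rewrite !ltn_exp2l //; lia.
rewrite /diam_pow; case: ifPn => [_|/set0P[w [m [_ wm heavy]]]].
  by rewrite lee_fin mulr_ge0 ?exprn_ge0.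
have en : m = n by exact: lvl wm.
move: wm heavy; rewrite en {m en} => wn heavy.
have le_diam : (diam (d2 R) (cylinder N j) <= (2^-1 ^+ n)%:E)%E.
  apply: diam_le; first by rewrite exprn_ge0.
  move=> u v [m [_ um _]] [m' [_ vm' _]].
  apply: d2_le_prefix; apply: node_prefix.
  by rewrite -[in LHS](lvl _ _ um) -[in RHS](lvl _ _ vm') um.
apply: le_trans (gt0_ler_poweR s_ge0 _ _ le_diam) _.
- by rewrite in_itv /= leey diam_ge0.
- by rewrite in_itv /= leey lee_fin exprn_ge0.
rewrite poweR_EFin lee_fin.
have -> : (2^-1 ^+ n) `^ s = theta ^+ n * rho ^+ n.
  rewrite -exprMn /theta divfK ?gt_eqF//.
  by rewrite exprn_powR.
by apply: ler_wpM2l => //; rewrite exprn_ge0.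
Qed.

(** A level n has total mass 1, hence contributes at most theta^n. The indices below 2^m are 0,
    which is no node, and the levels below [m]. *)
Let sum_level N m :
  (\sum_(0 <= j < 2 ^ m) diam_pow (d2 R) s (cylinder N j) <=
   ((1 - theta ^+ m) / (1 - theta))%:E)%E.
Proof.
elim: m => [|m IH].
  rewrite big_nat1 expr0 subrr mul0r /diam_pow ifT //.
  apply/eqP; rewrite -subset0 => w [n [_ wn _]].
  by have := node_itv w n; rewrite wn; have := expn_gt0 2 n; lia.
rewrite (@big_cat_nat _ _ _ (2 ^ m)%N) //=; last by rewrite leq_exp2l.
have -> : (1 - theta ^+ m.+1) / (1 - theta) =
    (1 - theta ^+ m) / (1 - theta) + theta ^+ m.
  by rewrite exprS; field; rewrite gt_eqF // subr_gt0.
rewrite EFinD; apply: leeD => //.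
rewrite -[leRHS]mule1 -[in leRHS](sum_bernoulli_mass m) -EFinM mulr_sumr.
rewrite -sumEFin !big_seq; apply: lee_sum => j.
by rewrite mem_index_iota => /diam_pow_cylinder; exact.
Qed.

Lemma hausdorff_measure_lty : (hausdorff_measure setT (d2 R) s A < +oo)%E.
Proof.
apply: (@le_lt_trans _ _ (1 - theta)^-1%:E); last exact: ltry.
apply: ge_ereal_sup => _ [e e0 <-].
have [N le_Ne] : exists N, 2^-1 ^+ N <= e.
  have [N _ /(_ N (leqnn N)) H] : \forall n \near \oo, 2^-1 ^+ n < e.
    have := @cvg_expr R 2^-1.
    rewrite ger0_norm // invf_lt1 // ltr1n => /(_ isT) /cvgrPdist_lt /(_ e e0).
    by apply: filterS => n; rewrite sub0r normrN ger0_norm ?exprn_ge0.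
  by exists N; exact: ltW.
apply: ge_ereal_inf.
exists (\sum_(0 <= j <oo) diam_pow (d2 R) s (cylinder N j))%E.
  exists (cylinder N) => //; split=> //.
  - by move=> i; apply: le_trans (diam_cylinder N i) _; rewrite lee_fin.
  - move=> w /A_heavy/(_ N)[n Nn heavy].
    by exists (node w n) => //; exists n.
apply: lime_le; first by apply: is_cvg_nneseries => *; exact: diam_pow_ge0.
apply: nearW => J.
(* Since J < 2^J, the partial sum is bounded by a sum over complete levels. *)
apply: (@le_trans _ _
    (\sum_(0 <= j < 2 ^ J) diam_pow (d2 R) s (cylinder N j))%E).
  rewrite [leRHS](@big_cat_nat _ _ _ J) //=; last exact/ltnW/ltn_expl.
  by rewrite leeDl // sume_ge0 // => *; exact: diam_pow_ge0.
apply: le_trans (sum_level N J) _; rewrite lee_fin ler_pdivrMr ?subr_gt0//.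
rewrite mulVf ?gt_eqF ?subr_gt0//.
by rewrite gerBl exprn_ge0.
Qed.

End CylinderCover.

(** * Frequencies of zeros and the entropy bound *)

Definition zeros (w : word) (n : nat) : nat := \sum_(k < n) ~~ w k.

Lemma zerosS w n : zeros w n.+1 = (zeros w n + ~~ w n)%N.
Proof. by rewrite /zeros big_ord_recr. Qed.

Lemma zeros_le w n : (zeros w n <= n)%N.
Proof.
elim: n => [|n IH]; first by rewrite /zeros big_ord0.
by rewrite zerosS; case: (w n) => /=; lia.
Qed.

Section FrequencyUpper.
Variable R : realType.

Lemma freq0E w n : freq0 R w n = (zeros w n)%:R / n%:R.
Proof.
congr (_%:R / _); rewrite /zeros -sum1_card big_mkcond /=.
by apply: eq_bigr => k _; rewrite unfold_in /=; case: (w k).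
Qed.

Definition recurrent_freq (p : R) : set word := [set w | forall e, 0 < e ->
  forall N, exists2 n, (N <= n)%N & `|freq0 R w n - p| < e].

Lemma freq_recurrent S (p : R) : freq S p `<=` recurrent_freq p.
Proof.
move=> w [_ /cvgrPdist_lt wp] e e0 N.
have [M _ wM] := wp e e0.
exists (maxn N M); first exact: leq_maxl.
by rewrite distrC; apply: wM; exact: leq_maxr.
Qed.

(** A late tail has its infimum within e of p: some term of it is below p + e, while all are above p
    - e. *)
Lemma limn_einf_recurrent (u : R ^nat) p :
  limn_einf (fun n => (u n)%:E) = p%:E ->
  forall e, 0 < e -> forall N, exists2 n, (N <= n)%N & `|u n - p| < e.
Proof.
move=> up e e0 N.
have : einfs (fun n => (u n)%:E) n @[n --> \oo] --> p%:E.
  by rewrite -up limn_einf_lim; exact: is_cvg_einfs.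
move=> /fine_cvgP[fin /cvgrPdist_lt /(_ e e0) near_p].
have [M _ HM] : \forall n \near \oo,
    einfs (fun n => (u n)%:E) n \is a fin_num /\
    `|p - fine (einfs (fun n => (u n)%:E) n)| < e by near do split.
have [] := HM (maxn N M) (leq_maxr _ _).
set i := einfs _ _ => i_fin; rewrite ltr_norml => /andP[lt_ie lt_pi].
have : (i < (p + e)%:E)%E by rewrite -[i]fineK // lte_fin; lra.
move=> /ereal_inf_ltP[_ [n /= Mn <-]]; rewrite lte_fin => un.
exists n; first exact: leq_trans (leq_maxl _ _) Mn.
have : (i <= (u n)%:E)%E by apply: ereal_inf_lbound; exists n.
rewrite -[i]fineK // lee_fin => ?.
by rewrite ltr_norml; apply/andP; split; lra.
Unshelve. all: by end_near. Qed.

Lemma freq_inf_recurrent S (p : R) : freq_inf S p `<=` recurrent_freq p.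
Proof. by move=> w [_ wp] e e0 N; exact: limn_einf_recurrent wp _ e0 N. Qed.

Lemma freq_sup_recurrent S (p : R) : freq_sup S p `<=` recurrent_freq p.
Proof.
move=> w [_ wp] e e0 N.
have : limn_einf (fun n => (- freq0 R w n)%:E) = (- p)%:E.
  by rewrite EFinN -wp -limn_einfN.
move=> /limn_einf_recurrent /(_ e e0 N)[n Nn wn]; exists n => //.
by move: wn; rewrite -opprD normrN.
Qed.

Lemma freq_subset_inf S (p : R) : freq S p `<=` freq_inf S p.
Proof.
move=> w [Sw wp]; split=> //.
have : (freq0 R w n)%:E @[n --> \oo] --> p%:E 
  by apply: cvg_EFin => //; exact: nearW.
by move=> /cvg_limn_einf_sup[].
Qed.

Lemma freq_subset_sup S (p : R) : freq S p `<=` freq_sup S p.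
Proof.
move=> w [Sw wp]; split=> //.
have : (freq0 R w n)%:E @[n --> \oo] --> p%:E 
  by apply: cvg_EFin => //; exact: nearW.
by move=> /cvg_limn_einf_sup[].
Qed.

Lemma powR_half (s : R) : 2^-1 `^ s = expR (- (s * ln 2)).
Proof.
by rewrite /powR ifF ?invr_eq0 ?pnatr_eq0// lnV ?posrE// mulrN.
Qed.

Lemma ln_bernoulli_mass (q : R) w n : 0 < q < 1 ->
  ln (bernoulli_mass q n (node w n)) =
  (zeros w n)%:R * ln q + (n - zeros w n)%:R * ln (1 - q).
Proof.
move=> /andP[q0 q1].
have prod_gt0 m : 0 < \prod_(i < m) (if w i then 1 - q else q).
  by apply: prodr_gt0 => i _; case: ifP => _; lra.
rewrite bernoulli_mass_node; elim: n => [|n IH].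
  by rewrite big_ord0 ln1 /zeros big_ord0 !mul0r addr0.
have wn0 : 0 < (if w n then 1 - q else q) by case: ifP => _; lra.
rewrite big_ord_recr /= lnM ?posrE ?prod_gt0//.
rewrite IH zerosS; have le_zn := zeros_le w n.
case: (w n) => /=; last by rewrite addn1 subSS -natr1; ring.
by rewrite addn0 subSn // -natr1; ring.
Qed.

(** Taking logarithms and dividing by [n] turns the comparison with the mass into a condition on the
    frequency alone. *)
Lemma expr_le_bernoulli_mass (q rho : R) w n : 0 < q < 1 -> 0 < rho ->
  (0 < n)%N ->
  ln rho <= freq0 R w n * ln q + (1 - freq0 R w n) * ln (1 - q) ->
  rho ^+ n <= bernoulli_mass q n (node w n).
Proof.
move=> q01 rho0 n0 le_ln; have /andP[q0 q1] := q01.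
have nR : 0 < n%:R :> R by rewrite ltr0n.
rewrite -ler_ln ?posrE ?exprn_gt0//; last first.
  rewrite bernoulli_mass_node.
  by apply: prodr_gt0 => i _; case: ifP => _; lra.
rewrite lnXn // ln_bernoulli_mass // natrB ?zeros_le//.
have -> : (zeros w n)%:R = freq0 R w n * n%:R.
  by rewrite freq0E divfK ?gt_eqF.
rewrite -[ln rho *+ n]mulr_natl; move: le_ln; rewrite -(ler_pM2l nR) => le_ln.
by apply: le_trans le_ln _; rewrite le_eqVlt; apply/orP; left; apply/eqP; ring.
Qed.

Lemma entropy2_ge0 (p : R) : 0 <= p <= 1 -> 0 <= entropy2 p.
Proof.
move=> /andP[p0 p1]; apply: divr_ge0; last first.
  by rewrite ln_ge0 // ler1n.
have h x : 0 <= x <= 1 -> 0 <= - x * ln x.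
  by move=> /andP[x0 x1]; rewrite mulNr -mulrN mulr_ge0 // oppr_ge0 ln_le0.
rewrite -[X in _ - X]opprK opprK -mulNr.
by apply: addr_ge0; apply: h; apply/andP; split; lra.
Qed.

(* For p = 0 or p = 1 the Bernoulli measure of parameter p itself would give
   mass 0 to nearly all words. *)
Lemma exists_bernoulli_parameter (p c : R) : 0 <= p <= 1 ->
  c < - (entropy2 p * ln 2) ->
  exists2 q, 0 < q < 1 & c < p * ln q + (1 - p) * ln (1 - q).
Proof.
have ln2 : 0 < ln 2 :> R by rewrite ln_gt0 // ltr1n.
move=> /andP[p0 p1]; rewrite /entropy2 divfK ?gt_eqF// => ltc.
have expc : c < 0 -> 0 < expR (c / 2) < 1.
  by move=> c0; rewrite expR_gt0 expR_lt1; lra.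
move: p0; rewrite le_eqVlt => /predU1P[p0|p0].
  rewrite -p0 subr0 ln1 in ltc *.
  have c0 : c < 0 by lra.
  have /andP[? ?] := expc c0.
  (* Only ln (1 - q) counts when p = 0; it equals c/2, which exceeds c as c < 0. *)
  exists (1 - expR (c / 2)); first by apply/andP; split; lra.
  by rewrite mul0r add0r mul1r opprB addrC subrK expRK; lra.
move: p1; rewrite le_eqVlt => /predU1P[p1|p1].
  rewrite p1 subrr ln1 in ltc *.
  have c0 : c < 0 by lra.
  exists (expR (c / 2)); first exact: expc.
  by rewrite mul0r addr0 mul1r expRK; lra.
by exists p; [rewrite p0|lra].
Qed.

Lemma dim_word_recurrent_le (p : R) : 0 <= p <= 1 ->
  (dim_word R (recurrent_freq p) <= (entropy2 p)%:E)%E.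
Proof.
move=> p01; have h0 := entropy2_ge0 p01.
have ln2 : 0 < ln 2 :> R by rewrite ln_gt0 // ltr1n.
apply: dimH_le => // s lt_hs.
(* Thus exp(c) = 2^(-s'), where s' is the midpoint of the entropy and [s]. *)
pose c := - ((s + entropy2 p) / 2 * ln 2).
have [q q01 ltc] : exists2 q, 0 < q < 1 & c < p * ln q + (1 - p) * ln (1 - q).
  apply: exists_bernoulli_parameter => //.
  by rewrite /c ltrN2 ltr_pM2r //; lra.
apply: (@hausdorff_measure_lty _ q _ (expR c)) => //; first by lra.
  by rewrite powR_half ltr_expR ltrN2 ltr_pM2r //; lra.
move=> w wp N.
(* [g] is the slack left by the choice of [q]. The exponent is affine in the frequency, with slope
   at most [K] in absolute value, so a frequency within g/(K+1) of [p] costs at most that slack. *)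
pose K := `|ln q| + `|ln (1 - q)|.
pose g := p * ln q + (1 - p) * ln (1 - q) - c.
have g0 : 0 < g by rewrite subr_gt0.
have K0 : 0 <= K by rewrite addr_ge0.
have K10 : 0 < K + 1 by lra.
have [n Nn wn] := wp (g / (K + 1)) (divr_gt0 g0 K10) N.+1.
exists n; first exact: ltnW.
apply: expr_le_bernoulli_mass; rewrite ?expR_gt0 ?expRK//.
  exact: leq_ltn_trans Nn.
set f := freq0 R w n in wn *.
have : `|(f - p) * (ln q - ln (1 - q))| <= g.
  rewrite normrM; apply: (@le_trans _ _ (g / (K + 1) * K)).
    by apply: ler_pM => //; [exact: ltW|exact: ler_normB].
  by rewrite mulrAC ler_pdivrMr // ler_wpM2l //; lra.
by rewrite ler_norml /g => /andP[? ?]; lra.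
Qed.

(** For q = 1/2 every node of level n has mass exactly 2^-n, so every word is heavy at every level
    for rho = 1/2. *)
Lemma dim_word_setT_le : (dim_word R setT <= 1)%E.
Proof.
apply: dimH_le => // s s1.
have h01 : 0 < (2^-1 : R) < 1 by apply/andP; split; lra.
apply: (@hausdorff_measure_lty _ 2^-1 _ 2^-1) => //; first by lra.
  rewrite -[ltRHS]powRr1 // !powR_half ltr_expR ltrN2 ltr_pM2r //.
  by rewrite ln_gt0 // ltr1n.
move=> w _ N; exists N.+1 => //.
apply: expr_le_bernoulli_mass => //.
have -> : 1 - 2^-1 = 2^-1 :> R by field.
by rewrite -mulrDl subrKC mul1r.
Qed.

End FrequencyUpper.

(** * Univoque words and the block code *)

(** If [w] began with 0, being above [compl w] would force [shift w] to begin with 1, hence to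
    exceed [w]. *)
Lemma Gamma_head w : Gamma w -> w 0%N.
Proof.
move=> /(_ 1%N isT)[[n [cw [cn sn]]] [m [sw [sm wm]]]].
case w0 : (w 0%N) => //.
case: n cw cn sn => [|n] cw cn sn; first by move: cn; rewrite /compl w0.
have w1 : w 1%N by rewrite -[w 1%N]/(iter 1 shift w 0%N) -cw // /compl w0.
case: m sw sm wm => [|m] sw sm wm; first by rewrite w0 in wm.
by have := sw 0%N isT; rewrite w0 /= /shift w1.
Qed.

(** If [w] begins with 1^m 0, then m bounds all runs: further on, a longer run of 1s would make a
    shift exceed [w], and a longer run of 0s would make it fall below [compl w]. *)
Lemma Gamma_subset_Lambda : Gamma `<=` Lambda.
Proof.
move=> w Gw; have w0 := Gamma_head Gw.
have ex0 : exists n, ~~ w n.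
  have [_ [m [_ [sm _]]]] := Gw 1%N isT.
  by exists m.+1; move: sm; rewrite iter_shiftE add1n => ->.
case: (ex_minnP ex0) => m wm _ {ex0}.
exists m => b i l run; rewrite leqNgt; apply/negP => lt_ml.
have [i0|i_gt0] := posnP i.
  have := run 0%N (leq_ltn_trans (leq0n _) lt_ml).
  have := run m lt_ml; rewrite i0 !add0n w0 => wmb b1.
  by rewrite wmb -b1 in wm.
have [[n [cw [cn sn]]] [n' [sw [sm wm']]]] := Gw i i_gt0.
case: b run => run.
- have /= : (l <= n')%N.
    rewrite leqNgt; apply/negP => /run.
    by rewrite -iter_shiftE sm.
  move=> /(leq_trans lt_ml)/sw.
  by rewrite iter_shiftE run // => wm1; rewrite -wm1 in wm.
- have /= : (l <= n)%N.
    rewrite leqNgt; apply/negP => /run.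
    by rewrite -iter_shiftE sn.
  move=> /(leq_trans lt_ml)/cw.
  by rewrite iter_shiftE run // /compl => /negbFE wm1; rewrite wm1 in wm.
Qed.

(** A shift first reads 1 where [compl w] is still in its initial 0s, and first reads 0 where [w] is
    still in its initial 1s; these two places decide the comparisons. *)
Lemma Gamma_windows m (w : word) : (forall i, (i < m)%N -> w i) ->
  (forall b k, (0 < k)%N -> exists2 i, (i < m)%N & w (k + i)%N = b) -> Gamma w.
Proof.
move=> w1 win k k0.
have first b : exists i, [/\ (i < m)%N, w (k + i)%N = b &
    forall j, (j < i)%N -> w (k + j)%N = ~~ b].
  have ex_i : exists i, w (k + i)%N == b.
    by have [i _ <-] := win b k k0; exists i.
  case: (ex_minnP ex_i) => i /eqP wi min_i; exists i; split=> //.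
    have [i' lt_i'm /eqP wi'] := win b k k0.
    exact: leq_ltn_trans (min_i _ wi') lt_i'm.
  move=> j lt_ji; have : w (k + j)%N != b.
    by apply: contraTN lt_ji => /min_i; rewrite -leqNgt.
  by move: (w _) => c; case: c; case: (b).
have [i [im wi before_i]] := first true.
have [j [jm wj before_j]] := first false.
split.
- exists i; split=> [r ri|]; last by rewrite iter_shiftE wi /compl w1.
  by rewrite iter_shiftE before_i // /compl w1 // (ltn_trans ri).
- exists j; split=> [r rj|]; last by rewrite iter_shiftE wj w1.
  by rewrite iter_shiftE before_j // w1 // (ltn_trans rj).
Qed.

Lemma exists_injective_into (S T : finType) (A : {set T}) : (#|S| <= #|A|)%N ->
  exists2 f : S -> T, injective f & forall s, f s \in A.
Proof.
move=> le_SA; exists (fun s => enum_val (widen_ord le_SA (enum_rank s))).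
  by move=> s1 s2 /enum_val_inj/(congr1 val)/= /val_inj/enum_rank_inj.
by move=> s; exact: enum_valP.
Qed.

Lemma zeros_add w n m :
  zeros w (n + m) = (zeros w n + \sum_(r < m) ~~ w (n + r))%N.
Proof. by rewrite /zeros big_split_ord. Qed.

(** * Coding arbitrary words by univoque words of frequency p *)

Section BlockCode.
Variables (R : realType) (L' k : nat) (p : R).
Let L := L'.+1.
Hypothesis k_gt0 : (0 < k)%N.
Hypothesis p01 : 0 <= p <= 1.
Hypothesis many_blocks : forall a : nat, `|a%:R - L%:R * p| <= 1 ->
  (0 < a < L)%N /\ (2 ^ k <= 'C(L, a))%N.

(** Number of zeros wanted in the first [i] blocks. Rounding this cumulative count, and not that of
    each block, keeps the error bounded. *)
Let target i := Num.truncn (i%:R * (L%:R * p)).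
Let quota i := (target i.+1 - target i)%N.

Let target_itv i : (target i)%:R <= i%:R * (L%:R * p) < (target i).+1%:R.
Proof. by apply: truncn_itv; case/andP: p01 => p0 _; rewrite !mulr_ge0. Qed.

Let targetS i : target i.+1 = (target i + quota i)%N.
Proof.
rewrite /quota subnKC //; apply: le_truncn.
by case/andP: p01 => p0 _; rewrite ler_wpM2r ?mulr_ge0 // ler_nat.
Qed.

Let quota_near i : `|(quota i)%:R - L%:R * p| <= 1.
Proof.
have := target_itv i; have := target_itv i.+1; rewrite targetS -!natr1 !natrD.
move=> /andP[? ?] /andP[? ?].
rewrite ler_norml; apply/andP; split; nra.
Qed.

Let bits := {ffun 'I_k -> bool}.

(** The possible sets of zeros of block [i] are the subsets of size [quota i] of its L positions, of
    which there are at least 2^k. *)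
Let exists_code : exists f : nat -> bits -> {set 'I_L},
  forall i, injective (f i) /\ forall b, #|f i b| = quota i.
Proof.
suff ex i : exists f : bits -> {set 'I_L},
    injective f /\ forall b, #|f b| = quota i.
  by have [f fP] := choice ex; exists f.
have [_ le_bin] := many_blocks (quota_near i).
have : (#|{: bits}| <= #|[set A : {set 'I_L} | #|A| == quota i]%SET|)%N.
  by rewrite card_ffun card_bool card_ord card_draws card_ord.
move=> /exists_injective_into[f f_inj fA]; exists f; split=> // b.
by have := fA b; rewrite inE => /eqP.
Qed.

Let code := projT1 (cid exists_code).

Let code_inj i : injective (code i).
Proof. by have [] := projT2 (cid exists_code) i. Qed.

Let card_code i b : #|code i b| = quota i.
Proof. by have [_] := projT2 (cid exists_code) i; exact. Qed.

Let chunk (u : word) i : bits := [ffun j : 'I_k => u (i * k + j)%N].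

(** The set coding a chunk is the set of zeros of its block. *)
Let body (u : word) : word :=
  fun n => inord (n %% L) \notin code (n %/ L) (chunk u (n %/ L)).

Let bodyE u i (r : 'I_L) : body u (i * L + r)%N = (r \notin code i (chunk u i)).
Proof.
rewrite /body divnMDl // divn_small // addn0 modnMDl modn_small //.
by rewrite inord_val.
Qed.

Let body_zeros u i : zeros (body u) (i * L) = target i.
Proof.
elim: i => [|i IH].
  by rewrite mul0n /zeros big_ord0 /target mul0r truncn0.
rewrite mulSnr zeros_add IH targetS -(card_code i (chunk u i)); congr (_ + _)%N.
rewrite -sum1_card [RHS]big_mkcond /=; apply: eq_bigr => r _.
by rewrite bodyE negbK; case: (r \in _).
Qed.

Let body_block u i b : exists2 r, (r < L)%N & body u (i * L + r)%N = b.
Proof.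
have [/andP[q0 qL] _] := many_blocks (quota_near i).
case: b.
- have : (0 < #|~: code i (chunk u i)|)%N.
    by have := cardsC (code i (chunk u i)); rewrite card_code card_ord; lia.
  move=> /card_gt0P[r]; rewrite finset.in_setC => rN.
  by exists r => //; rewrite bodyE.
- have : (0 < #|code i (chunk u i)|)%N by rewrite card_code.
  by move=> /card_gt0P[r rI]; exists r => //; rewrite bodyE rI.
Qed.

(** Equal blocks have equal sets of zeros, hence equal chunks since each code is injective. *)
Let body_prefix u v i : (forall n, (n < i * L)%N -> body u n = body v n) ->
  forall n, (n < i * k)%N -> u n = v n.
Proof.
move=> uv n lt_n.
have lt_i : (n %/ k < i)%N by rewrite ltn_divLR.
have /ffunP/(_ (Ordinal (ltn_pmod n k_gt0))) :
    chunk u (n %/ k) = chunk v (n %/ k).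
  apply: (@code_inj (n %/ k)); apply/setP => r; apply: negb_inj.
  rewrite -!bodyE uv //; apply: (@leq_trans ((n %/ k).+1 * L)).
    by rewrite mulSnr ltn_add2l.
  by rewrite leq_mul2r lt_i orbT.
by rewrite !ffunE /= -divn_eq.
Qed.

(** Length of the prefix 1^(2L) 0. The number 2L is such that every window of that length in the
    body contains a whole block, hence both digits. *)
Let head := (2 * L).+1.

Let full (u : word) : word := fun n =>
  if (n < 2 * L)%N then true
  else if n == (2 * L)%N then false else body u (n - head)%N.

Let full_body u n : full u (head + n)%N = body u n.
Proof.
rewrite /full !ifF ?addKn //; first by apply/negbTE; rewrite /head; lia.
by apply/negbTE; rewrite /head; lia.
Qed.

Let full_window u b n : (0 < n)%N ->
  exists2 i, (i < 2 * L)%N & full u (n + i)%N = b.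
Proof.
move=> n0; have [le_n|gt_n] := leqP n (2 * L).
  case: b; last first.
    exists (2 * L - n)%N; first by rewrite /L; lia.
    by rewrite subnKC // /full ltnn eqxx.
  have [E|ne] := eqVneq n (2 * L)%N; last first.
    by exists 0%N => //; rewrite addn0 /full ltn_neqAle ne le_n.
  have [r rL ur] := body_block u 0 true.
  exists r.+1; first by rewrite mul2n -addnn /L; move: rL; rewrite /L; lia.
  by rewrite E addnS -addSn full_body.
(* The block after the one where the window starts lies entirely inside the window. *)
pose x := (n - head)%N; pose i := (x %/ L).+1.
have [r rL ur] := body_block u i b.
exists (i * L + r - x)%N.
  have := divn_eq x L; have := ltn_pmod x (ltn0Sn L'); rewrite -/L /i.
  by move: (x %/ L)%N (x %% L)%N => y z; nia.
have -> : (n + (i * L + r - x) = head + (i * L + r))%N.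
  have : (x <= i * L)%N.
    have := divn_eq x L; have := ltn_pmod x (ltn0Sn L'); rewrite -/L /i.
    by move: (x %/ L)%N (x %% L)%N => y z; nia.
  by move: gt_n; rewrite /x /head; lia.
by rewrite full_body.
Qed.

Let full_Gamma u : Gamma (full u).
Proof.
apply: (@Gamma_windows (2 * L)) => [i lt_i|b n]; first by rewrite /full lt_i.
exact: full_window.
Qed.

(** Rounding costs at most 1 at the end of a block, and an incomplete block at most L more. *)
Let body_zeros_near u n : `|(zeros (body u) n)%:R - n%:R * p| <= L.+1%:R.
Proof.
have /andP[p0 p1] := p01.
rewrite (divn_eq n L) zeros_add body_zeros.
set i := (n %/ L)%N; set r := (n %% L)%N.
have rL : (r <= L)%N by rewrite ltnW // ltn_pmod.
have /andP[] := target_itv i.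
set S := (\sum_(_ < _) _)%N.
have le_Sr : (S <= r)%N.
  rewrite /S -[leqRHS]card_ord -sum1_card; apply: leq_sum => j _.
  exact: leq_b1.
move: le_Sr rL; rewrite -!(ler_nat R) !natrD natrM -!natr1 => ? ? ? ?.
have ? : 0 <= S%:R :> R by [].
have ? : 0 <= r%:R * p by rewrite mulr_ge0.
have ? : r%:R * p <= r%:R by rewrite ler_piMr.
by rewrite ler_norml; apply/andP; split; lra.
Qed.

Let zeros_near u n : `|(zeros (full u) n)%:R - n%:R * p| <= (3 * head)%:R.
Proof.
have /andP[p0 p1] := p01.
have small m : (m <= head)%N ->
    `|(zeros (full u) m)%:R - m%:R * p| <= head%:R.
  have := zeros_le (full u) m; rewrite -!(ler_nat R) => ? ?.
  have ? : 0 <= (zeros (full u) m)%:R :> R by [].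
  have ? : 0 <= m%:R * p by rewrite mulr_ge0.
  have ? : m%:R * p <= m%:R by rewrite ler_piMr.
  by rewrite ler_norml; apply/andP; split; lra.
have [le_n|gt_n] := leqP n head.
  by apply: le_trans (small n le_n) _; rewrite ler_nat leq_pmull.
rewrite -(subnKC (ltnW gt_n)); set m := (n - head)%N.
rewrite zeros_add; under eq_bigr do rewrite full_body.
rewrite -/(zeros (body u) m) !natrD mulrDl opprD addrACA.
apply: le_trans (ler_normD _ _) _.
apply: le_trans (lerD (small head (leqnn _)) (body_zeros_near u m)) _.
by rewrite -natrD ler_nat /head; lia.
Qed.

Let full_freq u : freq0 R (full u) n @[n --> \oo] --> p.
Proof.
apply/cvgrPdist_le => e e0.
exists (Num.truncn ((3 * head)%:R / e)).+1 => // n /= lt_n.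
have n0 : 0 < n%:R :> R by rewrite ltr0n (leq_trans _ lt_n).
have -> : p - freq0 R (full u) n =
    - (((zeros (full u) n)%:R - n%:R * p) / n%:R).
  by rewrite freq0E; field; rewrite gt_eqF.
rewrite normrN normrM normfV [X in _ / X]gtr0_norm //.
rewrite ler_pdivrMr // [leRHS]mulrC.
apply: le_trans (zeros_near u n) _.
rewrite -ler_pdivrMr //; apply/ltW/(lt_le_trans (truncnS_gt _)).
by rewrite ler_nat.
Qed.

(** If i complete blocks precede the first difference, [u] and [v] share ik letters, so their points
    are within 2^(-ik) = (2^(-iL))^(k/L). The images are at least a constant times 2^(-iL) apart,
    because a 1 soon follows in [full v]. *)
Let full_holder_digit u v n : (forall j, (j < n)%N -> full u j = full v j) ->
  full u n = false -> full v n = true ->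
  `|pi2 R u - pi2 R v| <= (2 ^+ (head + 3 * L)) `^ (k%:R / L%:R) *
     `|pi2 R (full u) - pi2 R (full v)| `^ (k%:R / L%:R).
Proof.
move=> uv un vn.
have le_hn : (head <= n)%N.
  rewrite leqNgt; apply/negP => lt_n.
  move: un; suff -> : full u n = full v n by rewrite vn.
  rewrite /full; case: ltnP => // le_n.
  by have -> : n == (2 * L)%N by rewrite eqn_leq le_n andbT -ltnS.
pose i := ((n - head) %/ L)%N.
have agree : forall j, (j < i * k)%N -> u j = v j.
  apply: body_prefix => j lt_j; rewrite -!full_body; apply: uv.
  rewrite -ltn_subRL; apply: leq_trans lt_j _.
  exact: leq_divM.
have [m lt_m vm] := @full_window v true n.+1 isT.
have := pi2_dist_ge R uv un vn vm.
have t0 : 0 <= k%:R / L%:R :> R by rewrite divr_ge0.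
(* Place n lies in block i, so n + 1 <= head + (i+1)L, and the next 1 of [full v] comes within 2L
   letters: together, head + 3L beyond iL. *)
move DE : (head + 3 * L)%N => D.
rewrite -powRM ?exprn_ge0 // => le_dist.
apply: le_trans (pi2_dist_le R agree) _.
have -> : 2^-1 ^+ (i * k) = (2^-1 ^+ (i * L)) `^ (k%:R / L%:R) :> R.
  rewrite -!powR_mulrn // -powRrM !natrM; congr (_ `^ _).
  by field; rewrite pnatr_eq0.
apply: ge0_ler_powR; rewrite ?nnegrE ?mulr_ge0 ?exprn_ge0 //.
apply: (@le_trans _ _ (2 ^+ D * 2^-1 ^+ (n.+1 + m.+1))); last first.
  by apply: ler_wpM2l => //; rewrite exprn_ge0.
rewrite exprVn exprVn ler_pdivlMr ?exprn_gt0 // mulrC ler_pdivrMr ?exprn_gt0//.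
rewrite -exprD ler_eXn2l ?ltr1n//.
have := divn_eq (n - head) L; have := ltn_pmod (n - head) (ltn0Sn L').
by rewrite -/L -/i -DE; lia.
Qed.

Lemma block_code_holder : exists F : word -> word,
  (forall u, freq Gamma p (F u)) /\
  exists2 C : R, 0 < C & forall u v, `|pi2 R u - pi2 R v| <=
    C * `|pi2 R (F u) - pi2 R (F v)| `^ (k%:R / L%:R).
Proof.
exists full; split=> [u|]; first by split.
exists ((2 ^+ (head + 3 * L)) `^ (k%:R / L%:R)).
  by rewrite powR_gt0 // exprn_gt0.
move=> u v.
have [uv|uv] := pselect (forall j, full u j = full v j).
  have -> : u = v.
    apply/funext => n.
    apply: (@body_prefix u v n.+1) => [j _|].
      by rewrite -!full_body uv.
    by rewrite (leq_trans (ltnSn n)) // leq_pmulr.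
  by rewrite subrr normr0 mulr_ge0 ?powR_ge0.
have ex_n : exists n, full u n != full v n.
  apply: contra_notP uv => uv j; apply/eqP.
  by apply: contra_notT uv => ?; exists j.
case: (ex_minnP ex_n) => n neq_n min_n.
have agree j : (j < n)%N -> full u j = full v j.
  by move=> lt_j; apply/eqP; apply: contraTT lt_j => /min_n; rewrite -leqNgt.
have [vn|vn] := boolP (full v n).
  apply: (full_holder_digit agree) => //.
  by move: neq_n; rewrite vn; case: (full u n).
rewrite distrC [X in _ * (X `^ _)]distrC.
apply: (@full_holder_digit _ _ n) => [j /agree //||].
  exact/negbTE.
by move: neq_n; rewrite (negbTE vn); case: (full u n).
Qed.

End BlockCode.

(** * Binomial coefficients and the lower bound *)

Section BinomialMode.
Local Open Scope nat_scope.
Variables a b : nat.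
Hypotheses (a_gt0 : 0 < a) (b_gt0 : 0 < b).

(** The terms of the expansion of (b + a)^(a+b), proportional to the binomial law of parameter
    a/(a+b). *)
Let term j := 'C(a + b, j) * (b ^ (a + b - j) * a ^ j).

Let term_ratio j : j < a + b ->
  term j.+1 * (j.+1 * b) = term j * ((a + b - j) * a).
Proof.
move=> lt_j; rewrite /term expnSr.
have -> : b ^ (a + b - j) = b * b ^ (a + b - j.+1).
  by rewrite -expnS; congr (_ ^ _); lia.
have := mul_bin_left (a + b) j; set x := 'C(_, _); set y := 'C(_, _).
set z := _ ^ _; set w := _ ^ _ => E.
transitivity (j.+1 * x * (z * w * a * b)); first by ring.
by rewrite E; ring.
Qed.

(** By [term_ratio], consecutive terms increase up to j = a and decrease afterwards. *)
Let term_le_mode j : j <= a + b -> term j <= term a.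
Proof.
have [le_ja _|lt_aj] := leqP j a.
  rewrite -(subKn le_ja); move: (a - j) (leq_subr j a) => d {le_ja j}.
  elim: d => [|d IH] le_d; first by rewrite subn0.
  apply: leq_trans (IH (ltnW le_d)).
  have lt_j : a - d.+1 < a + b by lia.
  have := term_ratio lt_j; rewrite -subSn // subSS => E.
  have : term (a - d.+1) * ((a - d) * b) <= term (a - d) * ((a - d) * b).
    rewrite E leq_mul2l; apply/orP; right.
    have -> : a + b - (a - d.+1) = b + d.+1 by lia.
    by apply: leq_trans (leq_mul (leq_subr d a) (leqnn b)) _; lia.
  by rewrite leq_pmul2r // muln_gt0 b_gt0 andbT subn_gt0.
rewrite -(subnKC (ltnW lt_aj)); move: (j - a) => d {lt_aj j}.
elim: d => [|d IH] le_d; first by rewrite addn0.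
apply: leq_trans (IH _); last by lia.
have lt_j : a + d < a + b by lia.
have := term_ratio lt_j; rewrite -addnS => E.
have : term (a + d.+1) * ((a + d.+1) * b) <= term (a + d) * ((a + d.+1) * b).
  rewrite E leq_mul2l; apply/orP; right.
  rewrite subnDl; apply: leq_trans (leq_mul (leq_subr d b) (leqnn a)) _.
  by lia.
by rewrite leq_pmul2r // muln_gt0 b_gt0 andbT addnS.
Qed.

(** The power is a sum of a+b+1 terms, none larger than the modal one. *)
Lemma binomial_mode_bound :
  (a + b) ^ (a + b) <= (a + b).+1 * ('C(a + b, a) * (b ^ b * a ^ a)).
Proof.
rewrite {1}[a + b]addnC expnDn -[X in _ <= X * _]card_ord -sum_nat_const.
apply: leq_sum => j _; apply: leq_trans (term_le_mode _) _.
  by rewrite -ltnS.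
by rewrite /term addKn.
Qed.

End BinomialMode.

(** * Entropy of binomial coefficients and choice of the block length *)

Section Lower.
Variable R : realType.

Definition shannon (x : R) := - x * ln x - (1 - x) * ln (1 - x).

Lemma ln_prod_le (x m c y z : R) (n b a : nat) :
  0 < x -> 0 < m -> 0 < c -> 0 < y -> 0 < z ->
  x ^+ n <= m * (c * (y ^+ b * z ^+ a)) ->
  n%:R * ln x <= ln m + (ln c + (b%:R * ln y + a%:R * ln z)).
Proof.
move=> x0 m0 c0 y0 z0.
have yb := exprn_gt0 b y0; have za := exprn_gt0 a z0.
have yz := mulr_gt0 yb za; have cyz := mulr_gt0 c0 yz.
rewrite -ler_ln ?posrE ?(mulr_gt0 m0 cyz) ?exprn_gt0 //.
by rewrite (lnM m0 cyz) (lnM c0 yz) (lnM yb za) !lnXn // !mulr_natl.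
Qed.

(** With b = n - a, n times the entropy is the logarithm of n^n / (a^a b^b), from which
    [binomial_mode_bound] loses only a factor n + 1. *)
Lemma ln_binomial_ge (n a : nat) : (0 < a < n)%N ->
  n%:R * shannon (a%:R / n%:R) - ln n.+1%:R <= ln ('C(n, a)%:R : R).
Proof.
move=> /andP[a0 an].
pose b := (n - a)%N; have b0 : (0 < b)%N by rewrite subn_gt0.
have nE : n = (a + b)%N by rewrite subnKC // ltnW.
have aR : 0 < a%:R :> R by rewrite ltr0n.
have bR : 0 < b%:R :> R by rewrite ltr0n.
have nR : 0 < n%:R :> R by rewrite ltr0n (leq_trans _ an).
have CR : 0 < 'C(n, a)%:R :> R by rewrite ltr0n bin_gt0 ltnW.
have := binomial_mode_bound a0 b0; rewrite -nE -(ler_nat R) !natrM !natrX.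
have n1R : 0 < n.+1%:R :> R by rewrite ltr0n.
move=> /(ln_prod_le nR n1R CR bR aR) le_ln.
have xE : 1 - a%:R / n%:R = b%:R / n%:R :> R.
  by rewrite nE natrD; field; rewrite -natrD -nE gt_eqF.
rewrite /shannon xE !ln_div ?posrE //.
have -> : n%:R * (- (a%:R / n%:R) * (ln a%:R - ln n%:R) -
    b%:R / n%:R * (ln b%:R - ln n%:R)) =
    (a%:R + b%:R) * ln n%:R - a%:R * ln a%:R - b%:R * ln b%:R :> R.
  by field; rewrite gt_eqF.
by move: le_ln; rewrite -natrD -nE; lra.
Qed.

Lemma shannon_continuous (p : R) : 0 < p < 1 -> {for p, continuous shannon}.
Proof.
move=> /andP[p0 p1].
have p10 : 0 < 1 - p by lra.
have cv1 : (1 - x : R) @[x --> p] --> 1 - p.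
  by apply: cvgB; [exact: cvg_cst|exact: cvg_id].
apply: cvgB; apply: cvgM => //.
- by apply: cvgN; exact: cvg_id.
- exact: continuous_ln.
- apply: continuous_comp => //.
  exact: continuous_ln.
Qed.

(** By continuity the entropy at a/n stays above c' ln 2 for n large; the loss ln (n+1) is absorbed
    by the gap between c' and c, leaving room for k = floor(nc) bits. *)
Lemma exists_block_parameters (p s : R) : 0 < p < 1 -> 0 <= s < entropy2 p ->
  exists L k, [/\ (0 < k)%N, s < k%:R / L.+1%:R &
    forall a : nat, `|a%:R - L.+1%:R * p| <= 1 ->
      (0 < a < L.+1)%N /\ (2 ^ k <= 'C(L.+1, a))%N].
Proof.
have square_succ j : (j * j.+2).+1 = (j.+1 ^ 2)%N by rewrite -mulnn; lia.
move=> p01 /andP[s0 lt_sH]; have /andP[p0 p1] := p01.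
have ln2 : 0 < ln 2 :> R by rewrite ln_gt0 // ltr1n.
pose H := entropy2 p.
have HE : shannon p = H * ln 2 by rewrite /H /entropy2 divfK ?gt_eqF.
(* The values s < c < c' < H are equally spaced, with step [g] below. *)
pose c := s + (H - s) / 3; pose c' := s + 2 * (H - s) / 3.
have Hs : 0 < H - s by rewrite subr_gt0.
have lt_cH : c' * ln 2 < shannon p by rewrite HE ltr_pM2r // /c'; lra.
have [e /= e0 near_p] : \forall x \near p, c' * ln 2 < shannon x.
  exact: (cvgr_gt _ (shannon_continuous p01)).
pose g := (H - s) / 3.
have g0 : 0 < g by rewrite divr_gt0.
have gl0 : 0 < g * ln 2 by rewrite mulr_gt0.
(* In this order, the terms put a/n within e of p, give 0 < a and a < n, absorb ln (n+1), and give s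
   < k/n. *)
pose K := e^-1 + p^-1 + (1 - p)^-1 + 2 / (g * ln 2) + g^-1.
have [m m0 Km] : exists2 m, (0 < m)%N & K < m%:R.
  by exists (Num.truncn K).+1 => //; exact: truncnS_gt.
have p10 : 0 < 1 - p by lra.
have ie := invr_gt0 e; rewrite e0 in ie.
have ip := invr_gt0 p; rewrite p0 in ip.
have ip1 := invr_gt0 (1 - p); rewrite p10 in ip1.
have ig := invr_gt0 g; rewrite g0 in ig.
have igl : 0 < 2 / (g * ln 2) by rewrite divr_gt0.
(* Then n + 1 = (m+1)^2, so ln (n+1) = 2 ln (m+1) <= 2m, which is small compared with n. *)
have [n nmE] : exists n, n = (m * m.+2)%N by exists (m * m.+2)%N.
have n0 : (0 < n)%N by rewrite nmE muln_gt0 m0.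
have nE : n = n.-1.+1 by rewrite prednK.
have mR : 0 < m%:R :> R by rewrite ltr0n.
have mn : m%:R <= n%:R :> R by rewrite ler_nat nmE leq_pmulr.
have nR : 0 < n%:R :> R by rewrite ltr0n.
have big x : 0 < x -> x^-1 <= K -> 1 < n%:R * x.
  move=> x0 xK; rewrite -ltr_pdivrMr // mul1r.
  exact: le_lt_trans xK (lt_le_trans Km mn).
have bige : 1 < n%:R * e by apply: big => //; rewrite /K; lra.
have bigp : 1 < n%:R * p by apply: big => //; rewrite /K; lra.
have bigp1 : 1 < n%:R * (1 - p) by apply: big => //; rewrite /K; lra.
have bigg : 1 < n%:R * g by apply: big => //; rewrite /K; lra.
have ln_small : ln n.+1%:R <= n%:R * (g * ln 2).
  rewrite nmE square_succ.
  rewrite natrX lnXn // -[ln _ *+ 2]mulr_natl.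
  have : ln m.+1%:R <= m%:R :> R.
    by rewrite -natr1 addrC le_ln1Dx // (lt_trans _ mR) // ltrN10.
  have : 2 < m%:R * (g * ln 2).
    by rewrite -ltr_pdivrMr //; move: Km; rewrite /K; lra.
  move=> h1 h2; rewrite natrM.
  apply: (@le_trans _ _ (m%:R * (m%:R * (g * ln 2)))).
    by rewrite mulrC ler_pM // ?ln_ge0 ?ler1n // ltW.
  by rewrite -mulrA ler_pM2l // ler_pM2r // ler_nat -addn2 leq_addr.
have c0 : 0 <= c by rewrite /c; lra.
pose k := Num.truncn (n%:R * c).
have /andP[le_k lt_k] : k%:R <= n%:R * c < k.+1%:R.
  by apply: truncn_itv; rewrite mulr_ge0.
have lt_sk : s < k%:R / n%:R.
  rewrite ltr_pdivlMr //; move: lt_k; rewrite -natr1 /c -/g; lra.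
exists n.-1, k; rewrite -nE; split=> //.
  have : 0 < k%:R / n%:R :> R by exact: le_lt_trans lt_sk.
  by rewrite pmulr_lgt0 ?invr_gt0 // ltr0n.
move=> a near_a.
have [a0 an] : (0 < a%:R :> R) /\ (a%:R < n%:R :> R).
  by move: near_a; rewrite ler_norml => /andP[? ?]; split; lra.
have an' : (0 < a < n)%N by rewrite -(ltr0n R) a0 -(ltr_nat R).
split=> //.
rewrite -(ler_nat R) natrX.
rewrite -ler_ln ?posrE ?exprn_gt0 ?ltr0n ?bin_gt0 //; last first.
  by rewrite ltnW //; case/andP: an'.
apply: le_trans (ln_binomial_ge an'); rewrite lnXn // -[ln 2 *+ k]mulr_natl.
have : c' * ln 2 < shannon (a%:R / n%:R).
  apply: near_p => /=.
  have -> : p - a%:R / n%:R = - ((a%:R - n%:R * p) / n%:R).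
    by field; rewrite gt_eqF.
  rewrite normrN normrM normfV [X in _ / X]gtr0_norm // ltr_pdivrMr //.
  by rewrite [ltRHS]mulrC; apply: le_lt_trans near_a _.
rewrite -(ltr_pM2l nR) => lt_sh.
have : k%:R * ln 2 <= n%:R * c * ln 2 by rewrite ler_pM2r.
have -> : c = c' - g by rewrite /c /c' /g; field.
by lra.
Qed.

Lemma entropy2_half : entropy2 (2^-1) = 1 :> R.
Proof.
have ln2 : 0 < ln 2 :> R by rewrite ln_gt0 // ltr1n.
rewrite /entropy2; have -> : 1 - 2^-1 = 2^-1 :> R by field.
by rewrite lnV ?posrE //; field; rewrite gt_eqF.
Qed.

Lemma dim_unit_freq_Gamma_ge (p : R) : 0 <= p <= 1 ->
  ((entropy2 p)%:E <= dim_unit (pi2 R @` freq Gamma p))%E.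
Proof.
move=> p01; apply: dimH_ge => s s0H; have /andP[s0 sH] := s0H.
(* At p = 0 or p = 1 the entropy is 0, which leaves no s with 0 <= s below it. *)
have p_int : 0 < p < 1.
  have /andP[p0 p1] := p01.
  rewrite !lt_neqAle p0 p1 !andbT; apply/andP; split; apply/eqP => pE.
    by move: sH; rewrite -pE /entropy2 subr0 ln1; lra.
  by move: sH; rewrite pE /entropy2 subrr ln1; lra.
have [L [k [k0 lt_sk blocks]]] := exists_block_parameters p_int s0H.
have [F [FG [C C0 FC]]] := block_code_holder k0 p01 blocks.
apply: (@holder_measure_infty _ _ _ _ _ _ (pi2 R \o F) (pi2 R) C _
  (k%:R / L.+1%:R)) => //=.
- by move=> u; exists (F u).
- by move=> x x01; exists (digits x); exact: pi2_digits.
- by rewrite s0.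
Qed.

Lemma dim_unit_le_dim_word A : (dim_unit (pi2 R @` A) <= dim_word R A)%E.
Proof.
apply: (@dimH_image_le _ _ _ _ _ _ _ (pi2 R)) => //.
- by move=> w _; rewrite /= in_itv /= pi2_ge0 pi2_le1.
- exact: pi2_lipschitz.
Qed.

Lemma dim_sandwich (p : R) A : 0 <= p <= 1 -> freq Gamma p `<=` A ->
  (dim_word R A <= (entropy2 p)%:E)%E ->
  dim_unit (pi2 R @` A) = (entropy2 p)%:E /\ dim_word R A = (entropy2 p)%:E.
Proof.
move=> p01 GA Ap.
have low : ((entropy2 p)%:E <= dim_unit (pi2 R @` A))%E.
  apply: le_trans (dim_unit_freq_Gamma_ge p01) _.
  by apply: dimH_subset; exact: image_subset.
have mid := dim_unit_le_dim_word A.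
by split; apply/eqP; rewrite eq_le;
  rewrite ?(le_trans mid Ap) ?low ?Ap ?(le_trans low mid).
Qed.

End Lower.

Unset Implicit Arguments.

Theorem theorem1p1 (R : realType) :
  (dim_unit (pi2 R @` Gamma) = 1%:E /\
   dim_word R Gamma = 1%:E /\
   dim_unit (pi2 R @` Lambda) = 1%:E /\
   dim_word R Lambda = 1%:E) /\
  (forall p : R, 0 <= p <= 1 ->
    dim_unit (pi2 R @` freq Gamma p) = (entropy2 p)%:E /\
    dim_unit (pi2 R @` freq_inf Gamma p) = (entropy2 p)%:E /\
    dim_unit (pi2 R @` freq_sup Gamma p) = (entropy2 p)%:E /\
    dim_word R (freq Gamma p) = (entropy2 p)%:E /\
    dim_word R (freq_inf Gamma p) = (entropy2 p)%:E /\
    dim_word R (freq_sup Gamma p) = (entropy2 p)%:E /\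
    dim_unit (pi2 R @` freq Lambda p) = (entropy2 p)%:E /\
    dim_unit (pi2 R @` freq_inf Lambda p) = (entropy2 p)%:E /\
    dim_unit (pi2 R @` freq_sup Lambda p) = (entropy2 p)%:E /\
    dim_word R (freq Lambda p) = (entropy2 p)%:E /\
    dim_word R (freq_inf Lambda p) = (entropy2 p)%:E /\
    dim_word R (freq_sup Lambda p) = (entropy2 p)%:E).
Proof.
split.
  have h01 : 0 <= (2^-1 : R) <= 1 by apply/andP; split; lra.
  (* Frequency 1/2 has entropy 1, already the largest possible dimension. *)
  have full A : freq Gamma (2^-1 : R) `<=` A ->
      dim_unit (pi2 R @` A) = 1%:E /\ dim_word R A = 1%:E.
    move=> GA; rewrite -(entropy2_half R); apply: dim_sandwich => //.
    rewrite entropy2_half; apply: le_trans (dim_word_setT_le R).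
    exact: dimH_subset.
  have [-> ->] : dim_unit (pi2 R @` Gamma) = 1%:E /\ dim_word R Gamma = 1%:E.
    by apply: full => w [].
  have [-> ->] : dim_unit (pi2 R @` Lambda) = 1%:E /\ dim_word R Lambda = 1%:E.
    by apply: full => w [/Gamma_subset_Lambda].
  by [].
move=> p p01.
have sandwich A : freq Gamma p `<=` A -> A `<=` recurrent_freq p ->
    dim_unit (pi2 R @` A) = (entropy2 p)%:E /\
    dim_word R A = (entropy2 p)%:E.
  move=> GA Ap; apply: dim_sandwich => //.
  by apply: le_trans (dim_word_recurrent_le p01); exact: dimH_subset.
have GL : freq Gamma p `<=` freq Lambda p.
  by move=> w [/Gamma_subset_Lambda].
have [-> ->] := sandwich _ (@subset_refl _ _) (@freq_recurrent _ Gamma p).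
have [-> ->] := sandwich _ (@freq_subset_inf _ Gamma p)
  (@freq_inf_recurrent _ Gamma p).
have [-> ->] := sandwich _ (@freq_subset_sup _ Gamma p)
  (@freq_sup_recurrent _ Gamma p).
have [-> ->] := sandwich _ GL (@freq_recurrent _ Lambda p).
have [-> ->] := sandwich _ (subset_trans GL (@freq_subset_inf _ Lambda p))
  (@freq_inf_recurrent _ Lambda p).
have [-> ->] := sandwich _ (subset_trans GL (@freq_subset_sup _ Lambda p))
  (@freq_sup_recurrent _ Lambda p).
by [].
Qed.
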